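(* Let $(S, +)$ be a commutative semigroup, let $(S, \times)$ be a semigroup (on the same underlying set $S$), and let $\sigma, \tau \in \operatorname{Sym}(S)$. Then there exists $\phi \in \operatorname{Aut}(S, +)$ that is a semigroup isomorphism or a semigroup anti-isomorphism from $(S, \times^{\sigma})$ to $(S, \times^{\tau})$ if and only if $\sigma$ and $\tau$ belong to the same double coset in $\operatorname{Aut}^*(S, \times) \backslash \operatorname{Sym}(S) / \operatorname{Aut}(S, +)$.
   Context: Mappings are written to the right of their arguments and composed from left to right, so $(x)\sigma\tau = ((x)\sigma)\tau$. $\operatorname{Sym}(S)$ denotes the symmetric group on the set $S$ (all bijections $S \to S$ under this composition). For a binary operation $\cdot : S \times S \to S$ and $\sigma \in \operatorname{Sym}(S)$, the binary operation $\cdot^{\sigma} : S \times S \to S$ is defined by $x \cdot^{\sigma} y = ((x)\sigma^{-1} \cdot (y)\sigma^{-1})\sigma$ for all $x, y \in S$ (if $\cdot$ is associative, so is $\cdot^{\sigma}$). A semigroup isomorphism from $(S, \times)$ to $(S, \otimes)$ is a bijection $\phi : S \to S$ with $(x \times y)\phi = (x)\phi \otimes (y)\phi$ for all $x, y \in S$; a (semigroup) anti-isomorphism from $(S, \times)$ to $(S, \otimes)$ is a bijection $\phi : S \to S$ with $(x \times y)\phi = (y)\phi \otimes (x)\phi$ for all $x, y \in S$. When the operations $\times$ and $\otimes$ coincide, these are called automorphisms and anti-automorphisms of $(S,\times)$, respectively. $\operatorname{Aut}(S, +)$ denotes the group of all automorphisms of $(S, +)$, and $\operatorname{Aut}^*(S,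 \times)$ denotes the group (under composition) of all bijections $S \to S$ that are automorphisms or anti-automorphisms of $(S, \times)$. For subgroups $H, K$ of a group $G$, the double cosets $H \backslash G / K$ are the sets of the form $\{hgk \mid h \in H, k \in K\}$ for $g \in G$, where products in $\operatorname{Sym}(S)$ are compositions from left to right. *)

(* Defs.v *)
From HB Require Import structures.
From mathcomp Require Import all_boot.
From mathcomp Require Import boolp classical_sets.

Set Implicit Arguments.
Unset Strict Implicit.
Unset Printing Implicit Defensive.

Local Open Scope group_scope.
Local Open Scope classical_set_scope.

(* [S] is an arbitrary, possibly infinite type, so [{perm S}] does not apply. *)
Record Sym (S : Type) := MkSym {
  symf :> S -> S;
  symi : S -> S;
  symfK : cancel symf symi;
  symiK : cancel symi symf
}.

Section SymGroup.
Variable S : Type.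
Implicit Types s t u : Sym S.

Lemma symP s t : s =1 t -> s = t.
Proof.
case: s t => f g fK gK [f' g' fK' gK'] /= /funext eqf; subst f'.
have eqg : g = g' by apply/funext => x; rewrite -{1}(gK' x) fK.
by subst g'; congr MkSym; exact: Prop_irrelevance.
Qed.

HB.instance Definition _ := gen_eqMixin (Sym S).
HB.instance Definition _ := gen_choiceMixin (Sym S).

Definition sym_one : Sym S := @MkSym S id id (frefl id) (frefl id).
Definition sym_inv s : Sym S := MkSym (@symiK S s) (@symfK S s).
(* Left-to-right composition: [sym_mul s t] applies [s] first. *)
Definition sym_mul s t : Sym S :=
  MkSym (can_comp (@symfK S t) (@symfK S s))
        (can_comp (@symiK S s) (@symiK S t)).

Lemma sym_mulA : associative sym_mul. Proof. by move=> s t u; apply: symP. Qed.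
Lemma sym_mul1l : left_id sym_one sym_mul.
Proof. by move=> s; apply: symP. Qed.
Lemma sym_mul1r : right_id sym_one sym_mul.
Proof. by move=> s; apply: symP. Qed.
Lemma sym_mulV : left_inverse sym_one sym_inv sym_mul.
Proof. by move=> s; apply: symP => x /=; rewrite symiK. Qed.
Lemma sym_mulVr : right_inverse sym_one sym_inv sym_mul.
Proof. by move=> s; apply: symP => x /=; rewrite symfK. Qed.

HB.instance Definition _ := isGroup.Build (Sym S)
  sym_mulA sym_mul1l sym_mul1r sym_mulV sym_mulVr.

Lemma symKV s : cancel s s^-1. Proof. exact: symfK. Qed.
Lemma symVK s : cancel s^-1 s. Proof. exact: symiK. Qed.

End SymGroup.

Section Semigroups.
Variable S : Type.
Implicit Types (op : S -> S -> S) (s phi : Sym S).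

Definition op_conj op s : S -> S -> S := fun x y => s (op (s^-1 x) (s^-1 y)).

Definition isomorphism op1 op2 phi : Prop :=
  {morph phi : x y / op1 x y >-> op2 x y}.

Definition anti_isomorphism op1 op2 phi : Prop :=
  {morph phi : x y / op1 x y >-> op2 y x}.

Definition Aut op : set (Sym S) := [set phi | isomorphism op op phi].

Definition Aut_star op : set (Sym S) :=
  [set phi | isomorphism op op phi \/ anti_isomorphism op op phi].

End Semigroups.

Section DoubleCosets.
Variable G : groupType.
Implicit Types (H K : set G) (g : G).

Definition is_subgroup H : Prop :=
  [/\ H 1, forall x, H x -> H x^-1 & forall x y, H x -> H y -> H (x * y)].

Definition double_coset H K g : set G := [set h * g * k | h in H & k in K].

Definition double_cosets H K : set (set G) :=
  [set double_coset H K g | g in [set: G]].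

End DoubleCosets.

Lemma op_conjA (S : Type) (op : S -> S -> S) (s : Sym S) :
  associative op -> associative (op_conj op s).
Proof. by move=> opA x y z; rewrite /op_conj !symKV opA. Qed.

Lemma Aut_subgroup (S : Type) (op : S -> S -> S) : is_subgroup (Aut op).
Proof.
split=> [|f fP|f g fP gP] x y //=.
  by apply: (can_inj (symKV f)); rewrite fP !symVK.
by rewrite fP gP.
Qed.

Lemma Aut_star_subgroup (S : Type) (op : S -> S -> S) :
  is_subgroup (Aut_star op).
Proof.
split=> [|f [] fP|f g [] fP [] gP]; [by left|left|right|left|right|right|left];
  move=> x y /=; rewrite ?fP ?gP //;
  by apply: (can_inj (symKV f)); rewrite fP !symVK.
Qed.

(* Main.v *)
Require Import Defs.
From mathcomp Require Import all_boot.
From mathcomp Require Import boolp classical_sets.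

(** Write composition from left to right.  By definition [sigma] is an
    isomorphism from [mul] to its conjugate by [sigma], and likewise for [tau].
    Hence [phi] is an isomorphism (or an anti-isomorphism) between the two
    conjugates exactly when the round trip [sigma * phi * tau^-1] is an
    automorphism (or an anti-automorphism) of [mul]; these transfers are
    [isomorphism_op_conj] and [anti_isomorphism_op_conj].

    What remains is group theory: for subgroups [H] and [K], two elements [s]
    and [t] lie in a common double coset if and only if [s * k * t^-1] is in
    [H] for some [k] in [K] ([same_double_cosetP]).  Taking [H] to be the group
    of automorphisms and anti-automorphisms of [mul], [K] the automorphism group
    of [add], and [k := phi] gives the equivalence. *)

(** If [s] and [t] are written [h * g * k] and [h' * g * k'], then [k^-1 * k']
    is the required element of [K]: it makes [g] cancel and leaves [h * h'^-1].
    Conversely, solving [h = s * k * t^-1] for [s] exhibits [s] in the double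
    coset of [t]. *)
Lemma same_double_cosetP (G : groupType) (H K : set G) (s t : G) :
  is_subgroup H -> is_subgroup K ->
  (exists C : set G, double_cosets H K C /\ C s /\ C t) <->
  (exists k : G, K k /\ H (s * k * t^-1)%g).
Proof.
case=> H1 HV HM [K1 KV KM]; split.
  case=> _ [[g _ <-] [[h Hh [k Kk <-]] [h' Hh' [k' Kk' <-]]]].
  exists (k^-1 * k')%g; split; first by apply: KM => //; apply: KV.
  suff -> : (h * g * k * (k^-1 * k') * (h' * g * k')^-1 = h * h'^-1)%g.
    by apply: HM => //; apply: HV.
  by rewrite !invgM !mulgA !mulgK.
case=> k [Kk Hk]; exists (double_coset H K t); split; first by exists t.
split; last by exists 1%g => //; exists 1%g => //; rewrite mul1g mulg1.
by exists (s * k * t^-1)%g => //; exists k^-1%g; [exact: KV|rewrite mulgVK mulgK].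
Qed.

(** The substitution [x := s x'] removes the [s^-1] hidden in the conjugate
    operation, and applying [t^-1] to both sides removes the [t].  Both steps
    are reversible because [s] and [t] are bijections. *)
Lemma isomorphism_op_conj (S : Type) (op : S -> S -> S) (s t phi : Sym S) :
  isomorphism (op_conj op s) (op_conj op t) phi <->
  isomorphism op op (s * phi * t^-1)%g.
Proof.
split=> phiP x y.
  by have /(congr1 t^-1%g) := phiP (s x) (s y); rewrite /op_conj !symKV.
have /(congr1 t) := phiP (s^-1%g x) (s^-1%g y).
by rewrite /= !symiK.
Qed.

Lemma anti_isomorphism_op_conj (S : Type) (op : S -> S -> S)
    (s t phi : Sym S) :
  anti_isomorphism (op_conj op s) (op_conj op t) phi <->
  anti_isomorphism op op (s * phi * t^-1)%g.
Proof.
split=> phiP x y.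
  by have /(congr1 t^-1%g) := phiP (s x) (s y); rewrite /op_conj !symKV.
have /(congr1 t) := phiP (s^-1%g x) (s^-1%g y).
by rewrite /= !symiK.
Qed.

Theorem theorem1p5 (S : Type) (add mul : S -> S -> S)
    (addA : associative add) (addC : commutative add)
    (mulA : associative mul) (sigma tau : Sym S) :
  (exists phi : Sym S,
     Aut add phi /\
     (isomorphism (op_conj mul sigma) (op_conj mul tau) phi \/
      anti_isomorphism (op_conj mul sigma) (op_conj mul tau) phi))
  <->
  (exists C : set (Sym S),
     double_cosets (Aut_star mul) (Aut add) C /\ C sigma /\ C tau).
Proof.
rewrite (same_double_cosetP _ _ _ _ _ (Aut_star_subgroup mul) (Aut_subgroup add)).
split=> -[phi [addphi mulphi]]; exists phi; split=> //;
  by case: mulphi => [/isomorphism_op_conj|/anti_isomorphism_op_conj]; [left|right].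
Qed.
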